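(* Let $a_1,x_1,y,z$ be nonzero complex numbers such that neither $a_1y$ nor $x_1z$ is of the form $q^{-m}$ with $m$ a nonnegative integer, and define for integers $n\ge0$ $$\Pi_n(a_1,x_1,y,z):=\sum_{k=0}^{n-1}q^k\frac{(a_1^2/q,x_1^2;q)_k}{(a_1y,x_1z;q)_k}.$$ Then (whenever no denominator vanishes) for every integer $n\ge0$ $$\Pi_n(a_1,x_1,y,z)=\frac{x_1(x_1-z)(a_1^2-q)}{a_1(a_1-y)(1-x_1z)}\Pi_n(a_1q^{1/2},x_1,y/q^{1/2},zq)+\frac{q-a_1y}{a_1(a_1-y)}\left\{1-\frac{(a_1^2/q,x_1^2;q)_n}{(a_1y/q,x_1z;q)_n}\right\},$$ and moreover $${}_2\phi_1\!\left[\begin{matrix}a_1^2/q,\ x_1^2\\ a_1y\end{matrix};q,q\right]+\frac{q-a_1y}{a_1(y-a_1)}\,{}_2\phi_1\!\left[\begin{matrix}a_1^2/q,\ x_1^2/q\\ a_1y/q\end{matrix};q,q\right]=\frac{q}{a_1(y-a_1)}\frac{(a_1^2/q,x_1^2;q)_\infty}{(a_1y,q;q)_\infty}.$$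
   Context: $q$ is a complex number with $0<|q|<1$ and $q^{1/2}$ a fixed square root. $(w;q)_\infty:=\prod_{j\ge0}(1-wq^j)$, $(w;q)_k:=\prod_{j=0}^{k-1}(1-wq^j)$, $(w_1,\dots,w_m;q)_k:=\prod_i(w_i;q)_k$ (also for $k=\infty$). ${}_2\phi_1\!\left[\begin{matrix}c_1,c_2\\ d_1\end{matrix};q,w\right]:=\sum_{n\ge0}\frac{(c_1,c_2;q)_n}{(d_1;q)_n}\frac{w^n}{(q;q)_n}$. *)

(* Defs.v *)
From Stdlib Require Import Reals List.
From Coquelicot Require Import Coquelicot.
Import ListNotations.
Open Scope C_scope.

(* Coquelicot's [lim] on a complete space is total: it is the limit when the
   sequence converges and an unspecified value otherwise. *)
Definition Clim_seq (u : nat -> C) : C :=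
  lim (T := C_CompleteNormedModule) (filtermap u eventually).

Definition CSeries (a : nat -> C) : C :=
  Clim_seq (sum_n (G := C_AbelianGroup) a).

Lemma Clim_seq_unique (u : nat -> C) (l : C) :
  filterlim u eventually (locally (T := C_UniformSpace) l) -> Clim_seq u = l.
Proof.
intros H.
apply (filterlim_locally_unique (K := C_AbsRing) (V := C_NormedModule)
         (F := eventually) u); [ | exact H].
intros P [eps HP].
assert (Hc : cauchy (T := C_CompleteNormedModule) (filtermap u eventually)).
{ intros e. exists l. apply H. now exists e. }
generalize (complete_cauchy (T := C_CompleteNormedModule)
              (filtermap u eventually) _ Hc eps).
unfold filtermap.
apply filter_imp. intros n Hn. apply HP. exact Hn.
Qed.

Lemma CSeries_unique (a : nat -> C) (l : C) :
  is_series (K := C_AbsRing) (V := C_NormedModule) a l -> CSeries a = l.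
Proof. exact (Clim_seq_unique _ l). Qed.

(* f 0 + ... + f (n - 1), with n terms; Coquelicot's [sum_n] has n + 1. *)
Fixpoint Csum (f : nat -> C) (n : nat) : C :=
  match n with
  | O => 0
  | S k => Csum f k + f k
  end.

Fixpoint qpoch (w q : C) (k : nat) : C :=
  match k with
  | O => 1
  | S j => qpoch w q j * (1 - w * q ^ j)
  end.

Definition qpoch_inf (w q : C) : C := Clim_seq (qpoch w q).

Definition Cprod_list (ws : list C) : C := fold_right Cmult 1 ws.

Definition qpochs (ws : list C) (q : C) (k : nat) : C :=
  Cprod_list (map (fun w => qpoch w q k) ws).

Definition qpochs_inf (ws : list C) (q : C) : C :=
  Cprod_list (map (fun w => qpoch_inf w q) ws).

Definition phi21 (c1 c2 d1 q w : C) : C :=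
  CSeries (fun n => qpochs [c1; c2] q n / qpoch d1 q n * (w ^ n / qpoch q q n)).

Definition PiSum (q : C) (n : nat) (a1 x1 y z : C) : C :=
  Csum (fun k => q ^ k * (qpochs [a1 ^ 2 / q; x1 ^ 2] q k
                          / qpochs [a1 * y; x1 * z] q k)) n.

(* Main.v *)
(* Both identities telescope. For the first, with A = a1^2/q, B = x1^2,
   C = a1 y, D = x1 z, each summand on the left minus its counterpart on the
   right is a multiple of the difference of consecutive values of
   (A, B; q)_n / (C/q, D; q)_n. The second is the limiting case D = q: the
   shifted sum then becomes, up to its first term, the series with
   parameters A, B/q; C/q, and the partial sums satisfy an exact identity
   whose right-hand side is a multiple of (A, B; q)_n / (C/q, q; q)_n. *)
Require Import Defs.
From Stdlib Require Import Reals List Lra Lia.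
From Coquelicot Require Import Coquelicot.
Import ListNotations.
Open Scope C_scope.
Set Bullet Behavior "Strict Subproofs".

(** * Nonvanishing factors and shifts of finite q-Pochhammer products *)

Lemma Cmult_neq_0_inv (a b : C) : a * b <> 0 -> a <> 0 /\ b <> 0.
Proof. intros H; split; intros E; apply H; rewrite E; ring. Qed.

Lemma one_minus_neq_0 (a b : C) : b <> 0 -> a <> / b -> 1 - a * b <> 0.
Proof.
intros Hb Ha E. apply Ha.
replace a with ((1 - (1 - a * b)) / b) by (field; exact Hb).
rewrite E. field. exact Hb.
Qed.

(** Both sides are $(w;q)_{n+1}$, with the factor of index 0 or the factor of index n split off. *)
Lemma qpoch_shift (w q : C) (n : nat) :
  (1 - w) * qpoch (w * q) q n = qpoch w q n * (1 - w * q ^ n).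
Proof.
induction n as [|n IH]; cbn [qpoch].
- simpl. ring.
- rewrite Cmult_assoc, IH, Cpow_S. ring.
Qed.

Lemma qpoch_div_shift (w q : C) (n : nat) : q <> 0 ->
  (1 - w / q) * qpoch w q n = qpoch (w / q) q n * (1 - w / q * q ^ n).
Proof.
intros Hq. rewrite <- qpoch_shift. do 2 f_equal. field. exact Hq.
Qed.

Lemma qpoch_neq_0 (w q : C) :
  (forall n, 1 - w * q ^ n <> 0) -> forall n, qpoch w q n <> 0.
Proof.
intros H n. induction n as [|n IH]; cbn [qpoch].
- exact C1_nz.
- apply Cmult_neq_0; [exact IH | apply H].
Qed.

Lemma one_minus_div_neq_0 (w q Q : C) : q <> 0 ->
  1 - w / q * Q <> 0 -> q - w * Q <> 0.
Proof.
intros Hq H E. apply H.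
replace (1 - w / q * Q) with ((q - w * Q) / q) by (field; auto).
rewrite E. field. auto.
Qed.

(** * The finite transformation *)

(** Here [Q] stands for $q^n$, the letters [a], [b], [c], [d] for $(A;q)_n$, $(B;q)_n$, $(C/q;q)_n$,
    $(D;q)_n$, and [a'], [c'], [d'] for $(Aq;q)_n$, $(C;q)_n$, $(Dq;q)_n$. The shift relations are
    the only facts about these products that matter; once they eliminate the primed letters, a
    rational identity in free variables remains. *)
Lemma transformation_step (A B C D a a' b c c' d d' Q q : C) :
  q <> 0 -> A * q - C <> 0 -> 1 - D <> 0 -> 1 - C / q <> 0 ->
  c <> 0 -> 1 - C / q * Q <> 0 -> d <> 0 -> 1 - D * Q <> 0 ->
  (1 - A) * a' = a * (1 - A * Q) ->
  (1 - C / q) * c' = c * (1 - C / q * Q) ->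
  (1 - D) * d' = d * (1 - D * Q) ->
  Q * (a * b / (c' * d)) =
    (B - D) * (A * q - q) / ((A * q - C) * (1 - D)) * (Q * (a' * b / (c' * d')))
    + (q - C) / (A * q - C)
      * (a * b / (c * d)
         - a * (1 - A * Q) * (b * (1 - B * Q))
           / (c * (1 - C / q * Q) * (d * (1 - D * Q)))).
Proof.
intros Hq HCA HD HC Hc HCQ Hd HDQ Ha' Hc' Hd'.
assert (HqC : q - C <> 0).
{ rewrite <- (Cmult_1_r C). apply one_minus_div_neq_0; [exact Hq|].
  now rewrite Cmult_1_r. }
assert (HqCQ := one_minus_div_neq_0 _ _ _ Hq HCQ).
assert (Ec : c' = c * (1 - C / q * Q) / (1 - C / q))
  by (rewrite <- Hc'; field; auto).
assert (Ed : d' = d * (1 - D * Q) / (1 - D)) by (rewrite <- Hd'; field; auto).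
assert (Hc'0 : c' <> 0).
{ intros E. apply (Cmult_neq_0 _ _ Hc HCQ). rewrite <- Hc', E. ring. }
assert (Hd'0 : d' <> 0).
{ intros E. apply (Cmult_neq_0 _ _ Hd HDQ). rewrite <- Hd', E. ring. }
(* [1 - A] may vanish, so [a'] can only be eliminated through [(1 - A) * a']. *)
replace ((B - D) * (A * q - q) / ((A * q - C) * (1 - D)) * (Q * (a' * b / (c' * d'))))
  with (- ((B - D) * q / ((A * q - C) * (1 - D)))
        * (Q * ((1 - A) * a' * b / (c' * d')))) by (field; auto).
rewrite Ha', Ec, Ed. field. repeat split; auto.
Qed.

Lemma Csum_transformation (A B C D q : C) (n : nat) :
  q <> 0 -> A * q - C <> 0 -> 1 - D <> 0 ->
  qpoch (C / q) q n <> 0 -> qpoch D q n <> 0 ->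
  Csum (fun k => q ^ k * (qpochs [A; B] q k / qpochs [C; D] q k)) n =
    (B - D) * (A * q - q) / ((A * q - C) * (1 - D))
      * Csum (fun k => q ^ k * (qpochs [A * q; B] q k / qpochs [C; D * q] q k)) n
    + (q - C) / (A * q - C)
      * (1 - qpochs [A; B] q n / qpochs [C / q; D] q n).
Proof.
intros Hq HCA HD. unfold qpochs, Cprod_list. cbn [map fold_right].
induction n as [|n IH]; intros HC HDn.
- cbn. field. auto.
- cbn [qpoch] in HC, HDn.
  apply Cmult_neq_0_inv in HC. destruct HC as [HC HCn].
  apply Cmult_neq_0_inv in HDn. destruct HDn as [HDn HDQ].
  (* This is the factor of index 0 of $(C/q;q)_{n+1}$: for $n=0$ it is the last factor, otherwise it
     divides $(C/q;q)_n$. *)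
  assert (HC1 : 1 - C / q <> 0).
  { destruct n as [|n].
    - cbn in HCn. now rewrite Cmult_1_r in HCn.
    - intros E. apply HC. clear IH HC HCn HDn HDQ.
      induction n as [|n IH]; cbn [qpoch].
      + cbn. rewrite Cmult_1_r, E. ring.
      + cbn [qpoch] in IH. rewrite IH. ring. }
  cbn [Csum]. rewrite (IH HC HDn). clear IH.
  rewrite !Cmult_1_r.
  rewrite (transformation_step A B C D _ (qpoch (A * q) q n) _ (qpoch (C / q) q n) _ _
             (qpoch (D * q) q n) _ q Hq HCA HD HC1 HC HCn HDn HDQ
             (qpoch_shift _ _ _) (qpoch_div_shift _ _ _ Hq) (qpoch_shift _ _ _)).
  cbn [qpoch]. ring.
Qed.

(** * The exact identity between partial sums of the two series *)

(** The second series is taken one index ahead, because $(B/q;q)_{n+1}=(1-B/q)(B;q)_n$ then has the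
    factor $(B;q)_n$ in common with the first, without any division by $1-B/q$. The right-hand side
    is an increment, ready to telescope. *)
Lemma contiguous_step (A B C q : C) (n : nat) :
  q <> 0 -> C - A * q <> 0 ->
  (forall k, qpoch (C / q) q k <> 0) -> (forall k, qpoch q q k <> 0) ->
  qpochs [A; B] q n / qpoch C q n * (q ^ n / qpoch q q n)
  + (q - C) / (C - A * q)
    * (qpochs [A; B / q] q (S n) / qpoch (C / q) q (S n)
       * (q ^ S n / qpoch q q (S n)))
  = (q - C) / (C - A * q)
    * (qpochs [A; B] q (S n) / qpochs [C / q; q] q (S n)
       - qpochs [A; B] q n / qpochs [C / q; q] q n).
Proof.
intros Hq HCA HC Hqq.
unfold qpochs, Cprod_list. cbn [map fold_right].
rewrite !Cmult_1_r.
assert (HB : qpoch (B / q) q (S n) = (1 - B / q) * qpoch B q n).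
{ cbn [qpoch]. symmetry. now apply qpoch_div_shift. }
rewrite HB.
assert (H1 := HC 1%nat). assert (Hn := HC n). assert (HSn := HC (S n)).
assert (Kn := Hqq n). assert (KSn := Hqq (S n)).
cbn in H1. rewrite Cmult_1_l, Cmult_1_r in H1.
cbn [qpoch] in *. rewrite Cpow_S.
apply Cmult_neq_0_inv in HSn. destruct HSn as [_ HSn].
apply Cmult_neq_0_inv in KSn. destruct KSn as [_ KSn].
assert (HqC : q - C <> 0).
{ rewrite <- (Cmult_1_r C). apply one_minus_div_neq_0; [exact Hq|].
  now rewrite Cmult_1_r. }
assert (HqCQ := one_minus_div_neq_0 _ _ _ Hq HSn).
assert (E : qpoch C q n = qpoch (C / q) q n * (1 - C / q * q ^ n) / (1 - C / q))
  by (rewrite <- (qpoch_div_shift _ _ _ Hq); field; auto).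
rewrite E. field. repeat split; auto.
Qed.

Lemma sum_n_C_Sn (f : nat -> C) (n : nat) :
  sum_n (G := C_AbelianGroup) f (S n) = sum_n (G := C_AbelianGroup) f n + f (S n).
Proof. exact (sum_Sn (G := C_AbelianGroup) f n). Qed.

Lemma sum_n_contiguous (A B C q : C) (n : nat) :
  q <> 0 -> C - A * q <> 0 ->
  (forall k, qpoch (C / q) q k <> 0) -> (forall k, qpoch q q k <> 0) ->
  sum_n (G := C_AbelianGroup)
    (fun k => qpochs [A; B] q k / qpoch C q k * (q ^ k / qpoch q q k)) n
  + (q - C) / (C - A * q)
    * sum_n (G := C_AbelianGroup)
        (fun k => qpochs [A; B / q] q k / qpoch (C / q) q k * (q ^ k / qpoch q q k))
        (S n)
  = (q - C) / (C - A * q) * (qpochs [A; B] q (S n) / qpochs [C / q; q] q (S n)).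
Proof.
intros Hq HCA HC Hqq.
induction n as [|n IH].
- rewrite (sum_n_C_Sn _ 0), !(sum_O (G := C_AbelianGroup)).
  rewrite Cmult_plus_distr_l.
  (* [u] is the term of index 0 of the second series, which has no partner in the first. It cancels
     the boundary value of the telescoping sum, the ratio at index 0 being 1. *)
  match goal with |- ?t + (?u + ?v) = _ => transitivity (u + (t + v)) end; [ring|].
  rewrite contiguous_step; auto.
  replace (qpochs [A; B] q 0 / qpochs [C / q; q] q 0) with (RtoC 1) by (cbn; field).
  generalize (qpochs [A; B] q 1 / qpochs [C / q; q] q 1). intros R1.
  cbn. field. exact HCA.
- rewrite (sum_n_C_Sn _ n), (sum_n_C_Sn _ (S n)).
  rewrite Cmult_plus_distr_l.
  match goal with |- (?s + ?t) + (?u + ?v) = _ => transitivity ((s + u) + (t + v)) end;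
    [ring|].
  rewrite contiguous_step; auto. rewrite IH. ring.
Qed.

(** * Limits of complex sequences *)

Definition Cconv (u : nat -> C) (l : C) : Prop :=
  filterlim u eventually (locally (T := C_UniformSpace) l).

Lemma Cconv_ext (u v : nat -> C) (l : C) :
  (forall n, u n = v n) -> Cconv u l -> Cconv v l.
Proof. intros E. apply filterlim_ext. exact E. Qed.

Lemma Cconv_unique (u : nat -> C) (l l' : C) : Cconv u l -> Cconv u l' -> l = l'.
Proof.
intros H H'. now rewrite <- (Clim_seq_unique u l H), <- (Clim_seq_unique u l' H').
Qed.

Lemma Cconv_const (c : C) : Cconv (fun _ => c) c.
Proof. apply filterlim_const. Qed.

Lemma Cconv_plus (u v : nat -> C) (l m : C) :
  Cconv u l -> Cconv v m -> Cconv (fun n => u n + v n) (l + m).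
Proof.
intros Hu Hv.
exact (filterlim_comp_2 u v Cplus Hu Hv
         (filterlim_plus (K := C_AbsRing) (V := C_NormedModule) l m)).
Qed.

Lemma Cconv_mult (u v : nat -> C) (l m : C) :
  Cconv u l -> Cconv v m -> Cconv (fun n => u n * v n) (l * m).
Proof.
intros Hu Hv P HP.
(* [filterlim_mult] is stated for the uniform structure derived from [Cmod]. *)
apply locally_C in HP.
refine (filterlim_comp_2 (G := locally (T := AbsRing_UniformSpace C_AbsRing) l)
         (H := locally (T := AbsRing_UniformSpace C_AbsRing) m)
         u v Cmult _ _ (filterlim_mult (K := C_AbsRing) l m) P HP).
- intros Q HQ. apply Hu. now apply locally_C.
- intros Q HQ. apply Hv. now apply locally_C.
Qed.

Lemma Cconv_S (u : nat -> C) (l : C) : Cconv u l -> Cconv (fun n => u (S n)) l.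
Proof.
intros H. refine (filterlim_comp _ _ _ S u _ _ _ _ H).
apply eventually_subseq. lia.
Qed.

Lemma Cconv_bounded (u : nat -> C) (l : C) :
  Cconv u l -> exists M : R, forall n, (Cmod (u n) <= M)%R.
Proof.
intros H.
destruct (filterlim_bounded (K := C_AbsRing) (V := C_NormedModule) u
            (ex_intro _ l H)) as [M HM].
exists M. exact HM.
Qed.

Lemma geometric_is_series (a : nat -> C) (M r : R) :
  (0 <= r < 1)%R -> (forall n, Cmod (a n) <= M * r ^ n)%R ->
  ex_series (K := C_AbsRing) (V := C_NormedModule) a.
Proof.
intros Hr Ha.
apply (ex_series_le (K := C_AbsRing) (V := C_CompleteNormedModule) a
         (fun n => M * r ^ n)%R).
- intros n. change (Cmod (a n) <= M * r ^ n)%R. apply Ha.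
- apply (ex_series_scal (K := R_AbsRing) (V := R_NormedModule) M (fun n => r ^ n)%R).
  apply ex_series_geom. rewrite Rabs_pos_eq; lra.
Qed.

Lemma geometric_ratio_bounded (b : nat -> R) (K r : R) :
  (0 <= K)%R -> (0 <= r < 1)%R -> (forall n, 0 <= b n)%R ->
  (forall n, b (S n) <= b n * (1 + K * r ^ n))%R ->
  forall n, (b n <= b 0%nat * exp (K / (1 - r)))%R.
Proof.
intros HK Hr Hb Hstep.
assert (H : forall n, (b n <= b 0%nat * exp (K * ((1 - r ^ n) / (1 - r))))%R).
{ induction n as [|n IH].
  - simpl. replace (K * ((1 - 1) / (1 - r)))%R with 0%R by (field; lra).
    rewrite exp_0. lra.
  - replace (K * ((1 - r ^ S n) / (1 - r)))%R
      with (K * ((1 - r ^ n) / (1 - r)) + K * r ^ n)%R by (simpl; field; lra).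
    rewrite exp_plus, <- Rmult_assoc.
    apply (Rle_trans _ _ _ (Hstep n)).
    assert (0 <= r ^ n)%R by (apply pow_le; lra).
    apply Rmult_le_compat; auto.
    + nra.
    + apply exp_ineq1_le. }
intros n. apply (Rle_trans _ _ _ (H n)).
apply Rmult_le_compat_l; [apply Hb|].
assert (Hn : (0 <= r ^ n)%R) by (apply pow_le; lra).
assert (Hle : (K * ((1 - r ^ n) / (1 - r)) <= K / (1 - r))%R).
{ unfold Rdiv. apply Rmult_le_compat_l; [exact HK|].
  rewrite <- (Rmult_1_l (/ (1 - r))) at 2.
  apply Rmult_le_compat_r; [|lra].
  apply Rlt_le, Rinv_0_lt_compat. lra. }
destruct Hle as [Hlt| ->]; [left; now apply exp_increasing | right; reflexivity].
Qed.

Lemma geometric_ratio_cvg (u : nat -> C) (K r : R) :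
  (0 <= K)%R -> (0 <= r < 1)%R ->
  (forall n, Cmod (u (S n) - u n) <= K * r ^ n * Cmod (u n))%R ->
  exists l, Cconv u l.
Proof.
intros HK Hr Hu.
set (M := (Cmod (u 0%nat) * exp (K / (1 - r)))%R).
assert (HM : forall n, (Cmod (u n) <= M)%R).
{ apply (geometric_ratio_bounded (fun n => Cmod (u n)) K r HK Hr).
  - intros n. apply Cmod_ge_0.
  - intros n. replace (u (S n)) with (u n + (u (S n) - u n)) by ring.
    apply (Rle_trans _ _ _ (Cmod_triangle _ _)).
    specialize (Hu n). lra. }
set (d := fun n => match n with O => u 0%nat | S k => u (S k) - u k end).
assert (Hd : forall n, sum_n (G := C_AbelianGroup) d n = u n).
{ induction n as [|n IH].
  - exact (sum_O (G := C_AbelianGroup) d).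
  - rewrite sum_n_C_Sn, IH. simpl. ring. }
destruct (proj2 (ex_series_incr_1 (K := C_AbsRing) (V := C_NormedModule) d)) as [l Hl].
- apply (geometric_is_series _ (K * M) r Hr). intros n. simpl.
  apply (Rle_trans _ _ _ (Hu n)).
  assert (0 <= r ^ n)%R by (apply pow_le; lra).
  replace (K * M * r ^ n)%R with (K * r ^ n * M)%R by ring.
  apply Rmult_le_compat_l; [nra | apply HM].
- exists l. exact (Cconv_ext _ _ _ Hd Hl).
Qed.

Lemma qpoch_inf_cvg (w q : C) :
  (Cmod q < 1)%R -> Cconv (qpoch w q) (qpoch_inf w q).
Proof.
intros Hq.
destruct (geometric_ratio_cvg (qpoch w q) (Cmod w) (Cmod q)) as [l Hl].
- apply Cmod_ge_0.
- split; [apply Cmod_ge_0 | exact Hq].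
- intros n. cbn [qpoch].
  replace (qpoch w q n * (1 - w * q ^ n) - qpoch w q n)
    with (- (w * q ^ n * qpoch w q n)) by ring.
  rewrite Cmod_opp, !Cmod_mult, Cmod_pow. apply Rle_refl.
- unfold qpoch_inf. now rewrite (Clim_seq_unique _ _ Hl).
Qed.

Lemma inv_one_minus_bounded (w q : C) :
  (Cmod q < 1)%R -> (forall n, 1 - w * q ^ n <> 0) ->
  exists M : R, forall n, (/ Cmod (1 - w * q ^ n) <= M)%R.
Proof.
intros Hq Hw.
assert (Hg : is_lim_seq (fun n => Cmod w * Cmod q ^ n)%R 0).
{ replace (Finite 0) with (Rbar_mult (Cmod w) 0) by (simpl; f_equal; ring).
  apply is_lim_seq_scal_l, is_lim_seq_geom.
  rewrite Rabs_pos_eq; [exact Hq | apply Cmod_ge_0]. }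
assert (H1 : is_lim_seq (fun n => Cmod (1 - w * q ^ n)) 1).
{ apply (is_lim_seq_le_le (fun n => 1 - Cmod w * Cmod q ^ n)%R _
           (fun n => 1 + Cmod w * Cmod q ^ n)%R).
  - intros n. rewrite <- Cmod_pow, <- Cmod_mult. set (x := w * q ^ n). split.
    + assert (H := Cmod_triangle (1 - x) x).
      replace (1 - x + x) with (RtoC 1) in H by ring. rewrite Cmod_1 in H. lra.
    + assert (H := Cmod_triangle 1 (- x)).
      rewrite Cmod_1, Cmod_opp in H. exact H.
  - replace (Finite 1) with (Finite (1 - 0)) by (f_equal; ring).
    apply is_lim_seq_minus'; [apply is_lim_seq_const | exact Hg].
  - replace (Finite 1) with (Finite (1 + 0)) by (f_equal; ring).
    apply is_lim_seq_plus'; [apply is_lim_seq_const | exact Hg]. }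
assert (H2 : is_lim_seq (fun n => / Cmod (1 - w * q ^ n))%R (/ 1)%R).
{ apply (is_lim_seq_inv _ 1 H1). intros E. injection E. lra. }
destruct (filterlim_bounded (K := R_AbsRing) (V := R_NormedModule)
            (fun n => / Cmod (1 - w * q ^ n))%R (ex_intro _ (/ 1)%R H2)) as [M HM].
exists M. intros n. exact (Rle_trans _ _ _ (Rle_abs _) (HM n)).
Qed.

Lemma qpoch_inf_inv_cvg (w q : C) :
  (Cmod q < 1)%R -> (forall n, 1 - w * q ^ n <> 0) ->
  qpoch_inf w q <> 0 /\ Cconv (fun n => / qpoch w q n) (/ qpoch_inf w q).
Proof.
intros Hq Hw.
assert (Hnz := qpoch_neq_0 w q Hw).
destruct (inv_one_minus_bounded w q Hq Hw) as [M HM].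
destruct (geometric_ratio_cvg (fun n => / qpoch w q n) (Cmod w * M) (Cmod q))
  as [l Hl].
- apply Rmult_le_pos; [apply Cmod_ge_0|].
  apply (Rle_trans _ _ _ (Rlt_le _ _ (Rinv_0_lt_compat _ (proj1 (Cmod_gt_0 _) (Hw 0%nat))))).
  apply HM.
- split; [apply Cmod_ge_0 | exact Hq].
- intros n. cbn [qpoch].
  replace (/ (qpoch w q n * (1 - w * q ^ n)) - / qpoch w q n)
    with (w * / (1 - w * q ^ n) * q ^ n * / qpoch w q n) by (field; auto).
  rewrite 3!Cmod_mult, (Cmod_inv (1 - w * q ^ n)), Cmod_pow; auto.
  apply Rmult_le_compat_r; [apply Cmod_ge_0|].
  apply Rmult_le_compat_r; [apply pow_le, Cmod_ge_0|].
  apply Rmult_le_compat_l; [apply Cmod_ge_0 | apply HM].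
- assert (E : qpoch_inf w q * l = 1).
  { apply (Cconv_unique (fun _ => 1)); [|apply Cconv_const].
    apply (Cconv_ext (fun n => qpoch w q n * / qpoch w q n)).
    - intros n. now apply Cinv_r.
    - apply Cconv_mult; [now apply qpoch_inf_cvg | exact Hl]. }
  assert (H0 : qpoch_inf w q <> 0).
  { intros E0. rewrite E0, Cmult_0_l in E. now apply C1_nz. }
  split; [exact H0|].
  replace (/ qpoch_inf w q) with l; [exact Hl|].
  rewrite <- (Cmult_1_l l), <- (Cinv_l _ H0), <- Cmult_assoc, E. ring.
Qed.

Lemma one_minus_qS_neq_0 (q : C) : (Cmod q < 1)%R -> forall n, 1 - q * q ^ n <> 0.
Proof.
intros Hq n E.
assert (E1 : q ^ S n = 1) by (rewrite Cpow_S, <- (Cplus_0_r (q * q ^ n)), <- E; ring).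
apply (f_equal Cmod) in E1. rewrite Cmod_pow, Cmod_1 in E1.
assert (H := pow_lt_1_compat (Cmod q) (S n) (conj (Cmod_ge_0 q) Hq) (Nat.lt_0_succ n)).
lra.
Qed.

Lemma phi21_cvg (c1 c2 d1 q : C) :
  (Cmod q < 1)%R -> (forall n, 1 - d1 * q ^ n <> 0) ->
  Cconv (sum_n (G := C_AbelianGroup)
           (fun n => qpochs [c1; c2] q n / qpoch d1 q n * (q ^ n / qpoch q q n)))
        (phi21 c1 c2 d1 q q).
Proof.
intros Hq Hd.
destruct (qpoch_inf_inv_cvg d1 q Hq Hd) as [_ Ld].
destruct (qpoch_inf_inv_cvg q q Hq (one_minus_qS_neq_0 q Hq)) as [_ Lq].
destruct (Cconv_bounded _ _
            (Cconv_mult _ _ _ _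
               (Cconv_mult _ _ _ _ (qpoch_inf_cvg c1 q Hq) (qpoch_inf_cvg c2 q Hq))
               (Cconv_mult _ _ _ _ Ld Lq))) as [M HM].
destruct (geometric_is_series
            (fun n => qpochs [c1; c2] q n / qpoch d1 q n * (q ^ n / qpoch q q n))
            M (Cmod q)) as [l Hl].
- split; [apply Cmod_ge_0 | exact Hq].
- intros n. unfold qpochs, Cprod_list. cbn [map fold_right].
  replace (qpoch c1 q n * (qpoch c2 q n * 1) / qpoch d1 q n * (q ^ n / qpoch q q n))
    with (qpoch c1 q n * qpoch c2 q n * (/ qpoch d1 q n * / qpoch q q n) * q ^ n)
    by (unfold Cdiv; ring).
  rewrite Cmod_mult, Cmod_pow.
  apply Rmult_le_compat_r; [apply pow_le, Cmod_ge_0 | apply HM].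
- unfold phi21. rewrite (CSeries_unique _ _ Hl). exact Hl.
Qed.

Lemma phi21_contiguous (A B C q : C) :
  q <> 0 -> (Cmod q < 1)%R -> C - A * q <> 0 ->
  (forall n, 1 - C / q * q ^ n <> 0) -> (forall n, 1 - C * q ^ n <> 0) ->
  phi21 A B C q q + (q - C) / (C - A * q) * phi21 A (B / q) (C / q) q q
  = q / (C - A * q) * (qpochs_inf [A; B] q / qpochs_inf [C; q] q).
Proof.
intros Hq0 Hq1 HCA HCq HC.
assert (Hqq := one_minus_qS_neq_0 q Hq1).
destruct (qpoch_inf_inv_cvg _ q Hq1 HCq) as [Hnz Linv].
destruct (qpoch_inf_inv_cvg _ q Hq1 HC) as [HnzC _].
destruct (qpoch_inf_inv_cvg _ q Hq1 Hqq) as [Hnzq Linvq].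
assert (H1 : 1 - C / q <> 0) by (rewrite <- (Cmult_1_r (C / q)); apply (HCq 0%nat)).
assert (HqC : q - C <> 0).
{ rewrite <- (Cmult_1_r C). apply one_minus_div_neq_0; [exact Hq0|].
  now rewrite Cmult_1_r. }
assert (Eshift : qpoch_inf (C / q) q = (1 - C / q) * qpoch_inf C q).
{ apply (Cconv_unique (fun n => qpoch (C / q) q (S n))).
  - apply Cconv_S. now apply qpoch_inf_cvg.
  - apply (Cconv_ext (fun n => (1 - C / q) * qpoch C q n)).
    + intros n. cbn [qpoch]. now apply qpoch_div_shift.
    + apply Cconv_mult; [apply Cconv_const | now apply qpoch_inf_cvg]. }
transitivity ((q - C) / (C - A * q)
              * (qpoch_inf A q * qpoch_inf B q
                 * (/ qpoch_inf (C / q) q * / qpoch_inf q q))).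
- eapply Cconv_unique.
  + apply Cconv_plus; [now apply phi21_cvg|].
    apply Cconv_mult; [apply Cconv_const|].
    apply Cconv_S. now apply phi21_cvg.
  + apply (Cconv_ext (fun n => (q - C) / (C - A * q)
                     * (qpoch A q (S n) * qpoch B q (S n)
                        * (/ qpoch (C / q) q (S n) * / qpoch q q (S n))))).
    * intros n. rewrite sum_n_contiguous; auto using qpoch_neq_0.
      unfold qpochs, Cprod_list. cbn [map fold_right]. rewrite !Cmult_1_r.
      field. repeat split; auto; now apply qpoch_neq_0.
    * apply Cconv_mult; [apply Cconv_const|].
      apply (Cconv_S (fun n => qpoch A q n * qpoch B q n
                               * (/ qpoch (C / q) q n * / qpoch q q n))).
      exact (Cconv_mult _ _ _ _
               (Cconv_mult _ _ _ _ (qpoch_inf_cvg A q Hq1) (qpoch_inf_cvg B q Hq1))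
               (Cconv_mult _ _ _ _ Linv Linvq)).
- unfold qpochs_inf, Cprod_list. cbn [map fold_right].
  rewrite Eshift. field. repeat split; auto.
Qed.

Theorem theorem3p13 (q sq : C)
  (hq0 : (0 < Cmod q)%R) (hq1 : (Cmod q < 1)%R) (hsq : sq ^ 2 = q)
  (a1 x1 y z : C) (ha1 : a1 <> 0) (hx1 : x1 <> 0) (hy : y <> 0) (hz : z <> 0)
  (ha1y : forall m : nat, a1 * y <> / q ^ m)
  (hx1z : forall m : nat, x1 * z <> / q ^ m)
  (ha1_y : a1 <> y) :
  (forall n : nat,
     qpochs [a1 * y / q; x1 * z] q n <> 0 ->
     PiSum q n a1 x1 y z =
       x1 * (x1 - z) * (a1 ^ 2 - q) / (a1 * (a1 - y) * (1 - x1 * z))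
         * PiSum q n (a1 * sq) x1 (y / sq) (z * q)
       + (q - a1 * y) / (a1 * (a1 - y))
         * (1 - qpochs [a1 ^ 2 / q; x1 ^ 2] q n
                / qpochs [a1 * y / q; x1 * z] q n))
  /\
  ((forall n : nat, qpoch (a1 * y / q) q n <> 0) ->
     phi21 (a1 ^ 2 / q) (x1 ^ 2) (a1 * y) q q
     + (q - a1 * y) / (a1 * (y - a1))
       * phi21 (a1 ^ 2 / q) (x1 ^ 2 / q) (a1 * y / q) q q
     = q / (a1 * (y - a1))
       * (qpochs_inf [a1 ^ 2 / q; x1 ^ 2] q / qpochs_inf [a1 * y; q] q)).
Proof.
assert (Hq : q <> 0) by (apply Cmod_gt_0; exact hq0).
assert (Hqn : forall n, q ^ n <> 0) by (intros n; now apply Cpow_nz).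
assert (Hsq : sq <> 0).
{ intros E. apply Hq. rewrite <- hsq, E. ring. }
assert (Hay : a1 - y <> 0).
{ intros E. apply ha1_y. rewrite <- (Cplus_0_r y), <- E. ring. }
assert (Hya : y - a1 <> 0).
{ intros E. apply ha1_y. rewrite <- (Cplus_0_r a1), <- E. ring. }
split.
- intros n Hn.
  unfold qpochs, Cprod_list in Hn. cbn [map fold_right] in Hn.
  rewrite Cmult_1_r in Hn. apply Cmult_neq_0_inv in Hn. destruct Hn as [HC HD].
  assert (HD1 : 1 - x1 * z <> 0).
  { rewrite <- (Cmult_1_r (x1 * z)). apply (one_minus_neq_0 _ (q ^ 0)); auto. }
  unfold PiSum.
  replace ((a1 * sq) ^ 2 / q) with (a1 ^ 2 / q * q)
    by (rewrite <- hsq; field; auto).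
  replace (a1 * sq * (y / sq)) with (a1 * y) by (field; auto).
  replace (x1 * (z * q)) with (x1 * z * q) by ring.
  rewrite (Csum_transformation (a1 ^ 2 / q) (x1 ^ 2) (a1 * y) (x1 * z) q n); auto.
  + replace (a1 ^ 2 / q * q - a1 * y) with (a1 * (a1 - y)) by (field; auto).
    f_equal. f_equal. field. auto.
  + replace (a1 ^ 2 / q * q - a1 * y) with (a1 * (a1 - y)) by (field; auto).
    now apply Cmult_neq_0.
- intros Hn.
  replace (a1 * (y - a1)) with (a1 * y - a1 ^ 2 / q * q) by (field; auto).
  apply phi21_contiguous; auto.
  + replace (a1 * y - a1 ^ 2 / q * q) with (a1 * (y - a1)) by (field; auto).
    now apply Cmult_neq_0.
  + intros n. apply (Cmult_neq_0_inv (qpoch (a1 * y / q) q n)). apply (Hn (S n)).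
  + intros n. apply one_minus_neq_0; auto.
Qed.
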